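(* Let $s\geq t\geq 3$ be integers, and let $G$ be a connected $K_{s,t}$-free graph of order $n$, where $n\geq s+t$. Then $$q(G)\leq n+(s-t+1)^{1/t}n^{1-1/t}+(t-1)(n-1)^{1-3/t}+t-3.$$
   Context: All graphs are finite and simple; the order of a graph is its number of vertices. For a graph $G$ with vertices $v_1,\dots,v_n$, let $A(G)$ be its adjacency matrix and $D(G)$ the diagonal matrix of its vertex degrees. The signless Laplacian matrix is $Q(G)=D(G)+A(G)$, and $q(G)$ denotes the largest eigenvalue of $Q(G)$. $K_{s,t}$ is the complete bipartite graph with parts of sizes $s$ and $t$. A graph is $K_{s,t}$-free if it does not contain $K_{s,t}$ as a (not necessarily induced) subgraph. *)

(* Defs.v *)
From HB Require Import structures.
From mathcomp Require Import all_boot all_order all_algebra.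
From mathcomp Require Import all_classical all_reals all_analysis.
From mathcomp Require spectral complex polyrcf.

Set Implicit Arguments.
Unset Strict Implicit.
Unset Printing Implicit Defensive.

Import Order.TTheory GRing.Theory Num.Theory.

Local Open Scope ring_scope.

Record sgraph (V : finType) := SGraph {
  adj :> rel V;
  adj_sym : symmetric adj;
  adj_irr : irreflexive adj }.

(* Also true of the empty graph, which has no vertices to join. *)
Definition connected_graph (V : finType) (G : sgraph V) : Prop :=
  forall x y : V, connect G x y.

(* The map f need not reflect adjacency: the copy of H in G is not required
   to be induced. *)
Definition contains_subgraph (V W : finType) (G : sgraph V) (H : sgraph W) :
  Prop :=
  exists f : W -> V, injective f /\ (forall x y : W, H x y -> G (f x) (f y)).

Definition Kst_rel (s t : nat) : rel ('I_s + 'I_t)%type :=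
  fun x y =>
    match x, y with
    | inl _, inr _ | inr _, inl _ => true
    | _, _ => false
    end.

Fact Kst_rel_sym (s t : nat) : symmetric (@Kst_rel s t).
Proof. by case=> ? []. Qed.

Fact Kst_rel_irr (s t : nat) : irreflexive (@Kst_rel s t).
Proof. by case. Qed.

Definition Kst (s t : nat) : sgraph ('I_s + 'I_t)%type :=
  SGraph (@Kst_rel_sym s t) (@Kst_rel_irr s t).

Definition Kst_free (s t : nat) (V : finType) (G : sgraph V) : Prop :=
  ~ contains_subgraph G (Kst s t).

Definition degree (V : finType) (G : sgraph V) (x : V) : nat :=
  #|[set y | G x y]|.

(* The vertices are numbered v_i := enum_val i, for i : 'I_#|V|. *)
Definition adjmx (R : realType) (V : finType) (G : sgraph V) : 'M[R]_#|V| :=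
  \matrix_(i, j) (G (enum_val i) (enum_val j))%:R.

Definition degmx (R : realType) (V : finType) (G : sgraph V) : 'M[R]_#|V| :=
  diag_mx (\row_i (degree G (enum_val i))%:R).

Definition signless_laplacian (R : realType) (V : finType) (G : sgraph V) :
  'M[R]_#|V| := degmx R G + adjmx R G.

(* The supremum is a maximum as soon as V is nonempty: see qindexP. *)
Definition qindex (R : realType) (V : finType) (G : sgraph V) : R :=
  sup [set a : R | eigenvalue (signless_laplacian R G) a]%classic.

Lemma signless_laplacian_sym (R : realType) (V : finType) (G : sgraph V) :
  (signless_laplacian R G)^T = signless_laplacian R G.
Proof.
rewrite /signless_laplacian linearD /= tr_diag_mx; congr (_ + _).
by apply/matrixP=> i j; rewrite !mxE adj_sym.
Qed.

Section SymmetricEigenvalue.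
Import complex.

Lemma sym_eigenvalue (R : realType) (n : nat) (A : 'M[R]_n) :
  (0 < n)%N -> A^T = A -> exists a : R, eigenvalue A a.
Proof.
move=> n_gt0 symA.
pose B : 'M[R[i]]_n := map_mx (@real_complex R) A.
have [l /eigenvalueP [v vB v0]] : exists l, eigenvalue B l.
  exact: spectral.eigenvalue_closed.
pose N : R[i] := \sum_j v 0 j * (v 0 j)^*.
pose S : R[i] := \sum_j (v *m B) 0 j * (v 0 j)^*.
have SE : S = l * N.
  by rewrite /S vB mulr_sumr; apply: eq_bigr => j _; rewrite mxE mulrA.
have Nr : N^* = N.
  by rewrite /N rmorph_sum; apply: eq_bigr => j _; rewrite rmorphM /= conjCK mulrC.
have Br i j : (B i j)^* = B j i.
  rewrite !mxE -[in RHS]symA mxE; apply/CrealP.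
  by apply/complex_realP; exists (A i j).
have Sr : S^* = S.
  rewrite /S rmorph_sum /=.
  under eq_bigr => j _ do rewrite mxE rmorphM rmorph_sum /= conjCK mulr_suml.
  under [RHS]eq_bigr => j _ do rewrite mxE mulr_suml.
  rewrite exchange_big /=; apply: eq_bigr => j _; apply: eq_bigr => i _.
  by rewrite rmorphM /= Br mulrC mulrA [LHS]mulrAC -!mulrA; congr (_ * _); rewrite mulrC.
have N0 : N != 0.
  apply: contra v0 => /eqP N0; apply/eqP/rowP=> j; rewrite mxE.
  have /(_ N0) : N = 0 -> forall i, true -> v 0 i * (v 0 i)^* = 0.
    by apply: psumr_eq0P => i _; exact: mul_conjC_ge0.
  by move=> /(_ j isT)/eqP; rewrite mul_conjC_eq0 => /eqP.
have /CrealP/complex_realP [a la] : l^* = l.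
  by apply: (mulIf N0); rewrite -{1}Nr -rmorphM /= -SE Sr SE.
exists a; rewrite eigenvalue_root_char -(fmorph_root (real_complex R)).
rewrite map_char_poly -eigenvalue_root_char.
by apply/eigenvalueP; exists v; rewrite ?vB ?la.
Qed.

End SymmetricEigenvalue.

Lemma qindexP (R : realType) (V : finType) (G : sgraph V) :
  (0 < #|V|)%N ->
  eigenvalue (signless_laplacian R G) (qindex R G) /\
  (forall a : R, eigenvalue (signless_laplacian R G) a -> a <= qindex R G).
Proof.
move=> V0; set Q := signless_laplacian R G.
have [a aQ] := sym_eigenvalue V0 (signless_laplacian_sym R G).
have rQ b : eigenvalue Q b = (b \in polyrcf.rootsR (char_poly Q)).
  have Q0 : char_poly Q != 0 by rewrite monic_neq0 ?char_poly_monic.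
  by rewrite eigenvalue_root_char -(polyrcf.roots_on_rootsR Q0) inE.
have [m [mQ maxm]] : exists m, eigenvalue Q m /\ forall b, eigenvalue Q b -> b <= m.
  have sP (s : seq R) : a \in s ->
      exists m, m \in s /\ forall b, b \in s -> b <= m.
    elim: s a {aQ} => // x [_ a _|y s IHs a _].
      by exists x; split=> [|b]; rewrite inE // => /eqP ->.
    have [m [ms mm]] := IHs y (mem_head _ _).
    have [xm|mx] := leP x m.
      exists m; split=> [|b]; first by rewrite inE ms orbT.
      by rewrite inE => /orP [/eqP -> //|]; exact: mm.
    exists x; split=> [|b]; first exact: mem_head.
    by rewrite inE => /orP [/eqP -> //|/mm bm]; exact: le_trans bm (ltW mx).
  have [|m [ms mm]] := sP (polyrcf.rootsR (char_poly Q)); first by rewrite -rQ.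
  by exists m; split=> [|b]; rewrite rQ //; exact: mm.
suff -> : qindex R G = m by [].
apply/eqP; rewrite eq_le; apply/andP; split.
  by apply: ge_sup; [exists m | move=> b; exact: maxm].
by apply: ub_le_sup => //; exists m => b; exact: maxm.
Qed.

(* Main.v *)
Require Import Defs.
From mathcomp Require Import all_boot all_order all_algebra.
From mathcomp Require Import all_classical all_reals all_analysis.
From mathcomp Require Import ring lra zify.

Import Order.TTheory GRing.Theory Num.Theory.
Local Open Scope ring_scope.

(** Conjugating the signless Laplacian by the diagonal matrix of degrees turns
    its row sums into d(u) + S(u) / d(u), where S(u) is the sum of the degrees
    of the neighbours of u; the largest eigenvalue is at most the largest of
    these ([qindex_le]).

    Fix u, of degree d, and put m = n - 1. The number S(u) - d counts the edges
    between N(u), as rows, and the other vertices, as columns, an edge inside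
    N(u) being counted from both sides. A set of t rows has at most s - 2
    common columns: together with u, one more would give K_{s,t}. This is a
    Zarankiewicz problem for a d x m matrix, and [ones_le_Zarankiewicz], with
    s - 2 split as (s - t + 1) + (t - 3), gives
      S(u) / d <= 1 + (s - t + 1)^(1/t) m^(1 - 1/t) + B m / d + (t - 3),
    where B = (t - 1) m^(1 - 3/t). If B <= d <= m, then
    d + B m / d <= m + B because (m - d)(d - B) >= 0, and this is the announced
    bound. If d < B, the trivial estimate S(u) / d <= m is already enough
    ([degree_add_mean_le]).

    The classical count of Kovari, Sos and Turan bounds the ones of a matrix
    in which t rows share at most c columns ([ones_le_base]). To replace the
    main constant (c + k)^(1/t) by c^(1/t), one argues by induction on k, in
    the manner of Furedi and Nikiforov: on the rows that meet a given column,
    the remaining columns form a matrix in which t rows share one column less.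
    Adding the bounds for all columns controls the sum of the squares of the
    row sums, hence the number of ones by Cauchy-Schwarz. *)

(** * Power means *)

(** The graph of the convex function x^(p+1) lies above its tangent at a. *)
Lemma exprn_tangent (R : realFieldType) (p : nat) (a x : R) :
  0 <= a -> 0 <= x -> p.+1%:R * a ^+ p * x - p%:R * a ^+ p.+1 <= x ^+ p.+1.
Proof.
move=> a0 x0; elim: p => [|p IHp]; first by rewrite !expr1 expr0; lra.
have := ler_wpM2l x0 IHp; rewrite -exprS; apply: le_trans.
rewrite -subr_ge0.
rewrite (_ : _ - _ = p.+1%:R * (a ^+ p * (x - a) ^+ 2)); last first.
  by rewrite !exprS expr0 -!natr1; ring.
by rewrite mulr_ge0 ?ler0n // mulr_ge0 ?sqr_ge0 ?exprn_ge0.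
Qed.

(** A power mean inequality without roots, where a prescribed value a takes the
    place of the mean: sum the tangent inequalities at a. *)
Lemma sum_le_of_sum_exprn (R : realFieldType) (I : finType) (J : {set I})
    (x : I -> R) (p : nat) (m a : R) :
  0 < a -> (forall j, 0 <= x j) -> #|J|%:R <= m ->
  \sum_(j in J) x j ^+ p.+1 <= m * a ^+ p.+1 ->
  \sum_(j in J) x j <= m * a.
Proof.
move=> a0 x0 Jm xm.
have a1 : 0 < p.+1%:R * a ^+ p by rewrite mulr_gt0 ?ltr0n ?exprn_gt0.
rewrite -(ler_pM2l a1) mulr_sumr.
have h : \sum_(j in J) p.+1%:R * a ^+ p * x j
    <= \sum_(j in J) (x j ^+ p.+1 + p%:R * a ^+ p.+1).
  by apply: ler_sum => j _; rewrite -lerBlDr exprn_tangent // ltW.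
apply: (le_trans h); rewrite big_split /= sumr_const -[_ *+ #|J|]mulr_natr.
have pa : 0 <= p%:R * a ^+ p.+1 by rewrite mulr_ge0 ?ler0n // exprn_ge0 // ltW.
have := ler_wpM2l pa Jm => h2; apply: (le_trans (lerD xm h2)).
by rewrite !exprS -natr1 le_eqVlt; apply/orP; left; apply/eqP; ring.
Qed.

Lemma sqr_sum_le (R : realFieldType) (I : finType) (D : {set I}) (x : I -> R) :
  (\sum_(i in D) x i) ^+ 2 <= #|D|%:R * \sum_(i in D) x i ^+ 2.
Proof.
set e := \sum_(i in D) x i; set d : R := #|D|%:R.
have [D0|D0] := eqVneq D finset.set0.
  by rewrite /e /d D0 !big_set0 cards0 expr0n mul0r.
have d0 : 0 < d by rewrite ltr0n card_gt0.
have : 0 <= \sum_(i in D) (d * x i - e) ^+ 2.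
  by apply: sumr_ge0 => i _; exact: sqr_ge0.
have -> : \sum_(i in D) (d * x i - e) ^+ 2 =
    d * (d * \sum_(i in D) x i ^+ 2 - e ^+ 2).
  transitivity (\sum_(i in D) (d ^+ 2 * x i ^+ 2 + (e ^+ 2 - 2 * d * e * x i))).
    by apply: eq_bigr => i _; ring.
  rewrite big_split sumrB /= -!mulr_sumr sumr_const -[_ *+ #|D|]mulr_natr.
  by rewrite -/d -/e; ring.
by rewrite pmulr_rge0 // subr_ge0.
Qed.

(** * A Zarankiewicz bound *)

Section Zarankiewicz.
Variables (R : realFieldType) (I J : finType) (E : I -> J -> bool).
Implicit Types (D : {set I}) (C : {set J}).

Definition ones D C : nat := (\sum_(j in C) #|[set i in D | E i j]|)%N.

(** For a set of vertices X of a graph and E its adjacency relation, this is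
    the common neighbourhood of X inside C. *)
Definition common_columns C (X : {set I}) : {set J} :=
  [set j in C | [forall i in X, E i j]].

Lemma ones_rows D C : ones D C = (\sum_(i in D) #|[set j in C | E i j]|)%N.
Proof.
rewrite /ones.
under eq_bigr => j _ do rewrite -sum1dep_card big_mkcondr.
under [RHS]eq_bigr => j _ do rewrite -sum1dep_card big_mkcondr.
exact: exchange_big.
Qed.

(** Double counting of the pairs formed by a column of C and a p-subset of its
    ones. *)
Lemma sum_binomial_columns D C p c :
  (forall X : {set I}, X \subset D -> #|X| = p -> (#|common_columns C X| <= c)%N) ->
  (\sum_(j in C) 'C(#|[set i in D | E i j]|, p) <= c * 'C(#|D|, p))%N.
Proof.
move=> cC.
under eq_bigr => j _ do rewrite -cards_draws -sum1dep_card big_mkcond /=.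
rewrite exchange_big /= -cards_draws mulnC -sum_nat_const.
rewrite [X in (_ <= X)%N]big_mkcond /=; apply: leq_sum => X _; rewrite inE.
case: ifP => [/andP[XD /eqP Xp]|XD].
  apply: leq_trans (cC X XD Xp); rewrite -big_mkcondr sum1dep_card.
  apply: subset_leq_card; apply/fintype.subsetP => j.
  rewrite !inE => /and3P[-> /fintype.subsetP XA _] /=.
  by apply/forall_inP => i /XA; rewrite inE => /andP[].
rewrite big1 // => j _; case: ifP => // /andP[XA Xp].
case/negP: (negbT XD); rewrite Xp andbT; apply: fintype.subset_trans XA _.
by apply/fintype.subsetP => i; rewrite inE => /andP[].
Qed.

(** Each of the p.+1 factors of the right side is at least a - p; truncated
    subtraction makes the left side 0 when a <= p. This replaces the binomials
    of the double count by powers, to which the power mean applies. *)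
Lemma subn_expn_le_ffact p a : ((a - p) ^ p.+1 <= a ^_ p.+1)%N.
Proof.
elim: p a => [|p IHp] a; first by rewrite subn0 expn1 ffactn1.
case: a => [|a]; first by rewrite sub0n exp0n.
rewrite subSS expnS ffactnS; apply: leq_mul; last exact: IHp.
by rewrite (leq_trans (leq_subr _ _)).
Qed.

Lemma ffact_le_expn p a : (a ^_ p <= a ^ p)%N.
Proof.
elim: p a => [|p IHp] a; first by rewrite ffactn0.
case: a => [|a] //; rewrite ffactnS expnS leq_mul2l /=.
apply: leq_trans (IHp _) _; case: p {IHp} => [|p]; first by rewrite !expn0.
by rewrite leq_exp2r ?leq_pred.
Qed.

(** The Kovari-Sos-Turan bound. The reals ga and mu stand for the (p+1)-th
    roots of c and of the number of columns, which keeps fractional exponents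
    out of the argument. The p first ones of each column are counted apart;
    for the others, the double count of (p+1)-subsets and the power mean
    inequality apply. *)
Lemma ones_le_base D C (p c : nat) (ga mu : R) :
  1 <= ga -> 1 <= mu -> #|C|%:R <= mu ^+ p.+1 -> c%:R <= ga ^+ p.+1 ->
  (forall X : {set I}, X \subset D -> #|X| = p.+1 -> (#|common_columns C X| <= c)%N) ->
  (ones D C)%:R <= ga * #|D|%:R * mu ^+ p + p%:R * mu ^+ p.+1.
Proof.
move=> ga1 mu1 Cm cg cC.
have mu0 : 0 < mu by lra.
have ga0 : 0 < ga by lra.
pose d j := #|[set i in D | E i j]|.
have h1 : (ones D C <= \sum_(j in C) (d j - p) + #|C| * p)%N.
  rewrite -sum_nat_const -big_split /=.
  by apply: leq_sum => j _; rewrite addnC -leq_subLR.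
rewrite -(ler_nat R) in h1; apply: (le_trans h1); rewrite natrD natrM natr_sum.
apply: lerD; last by rewrite mulrC ler_wpM2l ?ler0n.
have [D0|D0] := eqVneq D finset.set0.
  rewrite big1 ?mulr_ge0 ?exprn_ge0 ?ler0n ?ltW // => j _.
  rewrite /d D0 (_ : [set i in finset.set0 | E i j] = finset.set0) ?cards0 //.
  by apply/setP => i; rewrite !inE.
have d0 : 0 < #|D|%:R :> R by rewrite ltr0n card_gt0.
(* The mean number of remaining ones per column when the bound is attained. *)
pose a := ga * #|D|%:R / mu.
have a0 : 0 < a by rewrite divr_gt0 // mulr_gt0.
have -> : ga * #|D|%:R * mu ^+ p = mu ^+ p.+1 * a.
  by rewrite /a exprS; field; lra.
apply: (@sum_le_of_sum_exprn _ _ _ _ p) => //.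
have -> : mu ^+ p.+1 * a ^+ p.+1 = ga ^+ p.+1 * (#|D| ^ p.+1)%:R.
  by rewrite natrX -!exprMn /a; congr (_ ^+ _); field; lra.
apply: (@le_trans _ _ (c * #|D| ^ p.+1)%:R); last first.
  by rewrite natrM ler_wpM2r ?ler0n.
under eq_bigr => j _ do rewrite -natrX.
rewrite -natr_sum ler_nat.
apply: (@leq_trans (c * #|D| ^_ p.+1)%N); last by rewrite leq_mul2l ffact_le_expn orbT.
apply: (@leq_trans (\sum_(j in C) d j ^_ p.+1)%N).
  by apply: leq_sum => j _; exact: subn_expn_le_ffact.
have := sum_binomial_columns _ _ _ _ cC; rewrite -(leq_pmul2r (fact_gt0 p.+1)).
rewrite -mulnA bin_ffact big_distrl /=.
by under eq_bigr => j _ do rewrite bin_ffact.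
Qed.

(** The square of a row sum counts the ordered pairs (j, l) of ones of that
    row. Grouping them by j, the pairs with l != j are the ones of the matrix
    restricted to the rows that meet j, with j removed. *)
Lemma sum_sqr_rows D C :
  (\sum_(i in D) #|[set j in C | E i j]| ^ 2 =
   \sum_(j in C) (ones [set i in D | E i j] (C :\ j) + #|[set i in D | E i j]|))%N.
Proof.
transitivity (\sum_(j in C) \sum_(i in D | E i j) #|[set l in C | E i l]|)%N.
  rewrite (exchange_big_dep (mem D)) /=; last by move=> ? ? _ /andP[].
  apply: eq_bigr => i iD; rewrite expnS expn1 -sum_nat_const; apply: eq_bigl => j.
  by rewrite inE iD.
apply: eq_bigr => j jC; rewrite ones_rows -sum1_card -big_split /=.
apply: eq_big => [i|i /andP[iD Eij]]; first by rewrite inE.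
rewrite (cardsD1 j) inE jC Eij addnC; congr (_ + _)%N; congr #|pred_of_set _|.
by apply/setP => l; rewrite !inE andbA.
Qed.

(** Paying k ones per row and a larger error term lowers the main constant
    from (c + k)^(1/(p+1)) to c^(1/(p+1)). In the restriction to the rows that
    meet j, every set of rows has j as a common column, so once j is removed
    the bound c + k.+1 on common columns drops to c + k. *)
Theorem ones_le_Zarankiewicz (p c k : nat) (ga mu : R) D C :
  1 <= ga -> 1 <= mu -> #|C|%:R <= mu ^+ p.+1 -> c%:R <= ga ^+ p.+1 ->
  (forall X : {set I}, X \subset D -> #|X| = p.+1 ->
    (#|common_columns C X| <= c + k)%N) ->
  (ones D C)%:R <=
    ga * #|D|%:R * mu ^+ p + p%:R * mu ^+ (p.+1 + k) + k%:R * #|D|%:R.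
Proof.
move=> ga1 mu1; elim: k D C => [|k IHk] D C Cm cg cC.
  by rewrite mul0r addr0 addn0; apply: ones_le_base cg _ => //
    X XD /(cC _ XD); rewrite addn0.
set d := fun j => #|[set i in D | E i j]|.
have restrict j : j \in C ->
    (ones [set i in D | E i j] (C :\ j) + d j)%N%:R <=
    (ga * mu ^+ p + k.+1%:R) * (d j)%:R + p%:R * mu ^+ (p.+1 + k).
  move=> jC.
  have : (ones [set i in D | E i j] (C :\ j))%:R <=
      ga * (d j)%:R * mu ^+ p + p%:R * mu ^+ (p.+1 + k) + k%:R * (d j)%:R.
    apply: IHk => // [|X XD Xp].
      by apply: le_trans Cm; rewrite ler_nat subset_leq_card // subD1set.
    have XD' : X \subset D.
      by apply: fintype.subset_trans XD _; apply/fintype.subsetP => i; rewrite inE => /andP[].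
    have := cC X XD' Xp; rewrite (cardsD1 j) inE jC /=.
    have -> : [forall i in X, E i j].
      by apply/forall_inP => i /(fintype.subsetP XD); rewrite inE => /andP[].
    rewrite addnS add1n ltnS; apply: leq_trans; apply: subset_leq_card.
    by apply/fintype.subsetP => l; rewrite !inE -andbA.
  by rewrite natrD -natr1; lra.
set e : R := (ones D C)%:R; set dD : R := #|D|%:R.
have e0 : 0 <= e by exact: ler0n.
have dD0 : 0 <= dD by exact: ler0n.
set nu := mu ^+ p; set B := p%:R * mu ^+ (p.+1 + k.+1); set L := ga * nu + k.+1%:R.
have nu1 : 1 <= nu by exact: exprn_ege1.
have B0 : 0 <= B by rewrite mulr_ge0 ?ler0n // exprn_ge0; lra.
have Lnu : nu <= L.
  have : 0 <= k.+1%:R :> R by exact: ler0n.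
  by rewrite /L; nra.
(* At most mu^(p+1) columns contribute the constant term of their bound. *)
have sq : \sum_(i in D) #|[set j in C | E i j]|%:R ^+ 2 <= L * e + B * nu.
  have -> : \sum_(i in D) #|[set j in C | E i j]|%:R ^+ 2 =
      (\sum_(i in D) #|[set j in C | E i j]| ^ 2)%N%:R :> R.
    by rewrite natr_sum; apply: eq_bigr => i _; rewrite natrX.
  rewrite sum_sqr_rows natr_sum.
  apply: (le_trans (ler_sum _ restrict)).
  rewrite big_split /= -mulr_sumr -natr_sum -/e sumr_const -[_ *+ #|C|]mulr_natr.
  rewrite lerD2l; have -> : B * nu = p%:R * mu ^+ (p.+1 + k) * mu ^+ p.+1.
    by rewrite /B /nu -!mulrA -!exprD; congr (_ * _ ^+ _); lia.
  by rewrite ler_wpM2l // mulr_ge0 ?ler0n // exprn_ge0; lra.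
have : e ^+ 2 <= dD * (L * e + B * nu).
  apply: le_trans (ler_wpM2l dD0 sq); apply: le_trans (sqr_sum_le _ _ _ _).
  by rewrite -natr_sum -ones_rows.
(* The quadratic inequality e^2 <= dD * (L * e + B * nu) fails for
   e > dD * L + B, because nu <= L. *)
move=> ee; rewrite (_ : _ + _ = dD * L + B); last by rewrite /L; ring.
rewrite leNgt; apply/negP => lt.
have dLB : 0 <= dD * L by rewrite mulr_ge0 //; lra.
have e1 : 0 < e by lra.
have h1 : e * (dD * L + B) < e ^+ 2 by rewrite expr2 ltr_pM2l.
have h2 : B * (dD * nu) <= B * e.
  by rewrite ler_wpM2l //; have := ler_wpM2l dD0 Lnu; lra.
lra.
Qed.

End Zarankiewicz.

(** * The largest eigenvalue *)

(** Take an eigenvector x for the largest eigenvalue and a vertex j at which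
    |x_j| / d_j is maximal. The j-th eigenvalue equation then bounds
    (q - d_j) d_j by the sum of the degrees of the neighbours of j. *)
Lemma qindex_le (R : realType) (V : finType) (G : sgraph V) (b : R) :
  (0 < #|V|)%N -> (forall u, (0 < degree G u)%N) ->
  (forall u, (degree G u)%:R + (\sum_(v | G u v) degree G v)%N%:R / (degree G u)%:R <= b) ->
  qindex R G <= b.
Proof.
move=> V0 d0 hb; have [+ _] := qindexP R G V0; set q := qindex R G.
move=> /eigenvalueP[x xQ x0].
pose d (j : 'I_#|V|) : R := (degree G (enum_val j))%:R.
have dgt0 j : 0 < d j by rewrite ltr0n.
have xE j : (q - d j) * x 0 j = \sum_(i < #|V|) x 0 i * (G (enum_val i) (enum_val j))%:R.
  have := congr1 (fun M : 'rV_#|V| => M 0 j) xQ.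
  rewrite /signless_laplacian mulmxDr mul_mx_diag !mxE mulrBl => <-.
  rewrite mulrC addrAC subrr add0r.
  by apply: eq_bigr => i _; rewrite !mxE.
have /rV0Pn[j0 xj0] := x0.
have [j _ jmax] := @arg_maxP _ R _ j0 predT (fun j => `|x 0 j| / d j) isT.
set y := `|x 0 j| / d j in jmax.
have y0 : 0 < y by apply: lt_le_trans (jmax j0 isT); rewrite divr_gt0 ?normr_gt0.
have le_sum : (q - d j) * d j <= (\sum_(v | G (enum_val j) v) degree G v)%N%:R.
  rewrite -(ler_pM2l y0).
  have -> : y * ((q - d j) * d j) = (q - d j) * `|x 0 j|.
    by rewrite mulrCA /y divfK ?gt_eqF.
  apply: (@le_trans _ _ `|(q - d j) * x 0 j|).
    by rewrite normrM ler_wpM2r // ler_norm.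
  rewrite xE; apply: (le_trans (ler_norm_sum _ _ _)).
  rewrite natr_sum mulr_sumr (reindex _ (onW_bij _ (@enum_val_bij V))) /=.
  rewrite [leRHS]big_mkcond; apply: ler_sum => i _.
  rewrite normrM normr_nat adj_sym; case: ifP => _; last by rewrite mulr0.
  by rewrite mulr1 -ler_pdivrMr ?dgt0 //; exact: (jmax i isT).
apply: le_trans (hb (enum_val j)); rewrite -/(d j) -lerBlDl.
by rewrite ler_pdivlMr.
Qed.

(** * Graphs without a complete bipartite subgraph *)

Lemma connected_degree_gt0 (V : finType) (G : sgraph V) (u : V) :
  connected_graph G -> (1 < #|V|)%N -> (0 < degree G u)%N.
Proof.
move=> conn V1; have : (0 < #|[set~ u]|)%N by rewrite cardsC1; lia.
move=> /card_gt0P[v]; rewrite !inE => vu.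
have /connectP[[|w c] /=] := conn u v; first by move=> _ vE; rewrite vE eqxx in vu.
by move=> /andP[uw _] _; apply/card_gt0P; exists w; rewrite inE.
Qed.

Lemma degree_le (V : finType) (G : sgraph V) (u : V) : (degree G u <= #|V|.-1)%N.
Proof.
rewrite -(cardsC1 u); apply: subset_leq_card; apply/fintype.subsetP => v.
by rewrite !inE; apply: contraTneq => ->; rewrite adj_irr.
Qed.

(** Irreflexivity makes X disjoint from its common neighbourhood, so s common
    neighbours of t vertices would span a copy of K_{s,t}. *)
Lemma Kst_free_common (s t : nat) (V : finType) (G : sgraph V) (X : {set V}) :
  Kst_free s t G -> #|X| = t -> (#|common_columns _ _ G [set: V] X| < s)%N.
Proof.
move=> free Xt; rewrite ltnNge; apply/negP => sW; apply: free.
set W := common_columns _ _ G _ _ in sW.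
pose f (x : 'I_s + 'I_t) : V := match x with
  | inl i => enum_val (widen_ord sW i)
  | inr j => enum_val (cast_ord (esym Xt) j) end.
have XW a b : G (f (inr b)) (f (inl a)).
  have := enum_valP (widen_ord sW a); rewrite inE => /andP[_ /forall_inP]; apply.
  exact: enum_valP.
exists f; split.
- move=> [a|a] [b|b] eqf.
  + by move/enum_val_inj/(congr1 val): eqf => /= /val_inj ->.
  + by have := XW a b; rewrite eqf adj_irr.
  + by have := XW b a; rewrite eqf adj_irr.
  + by move/enum_val_inj/cast_ord_inj: eqf => ->.
- by move=> [a|a] [b|b] //= _; [rewrite adj_sym|]; exact: XW.
Qed.

(** Each neighbour of u contributes its edge to u, and its other edges are the
    ones of its row. *)
Lemma sum_degree_neighbours (V : finType) (G : sgraph V) (u : V) :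
  (\sum_(v | G u v) degree G v =
   degree G u + ones _ _ G [set v | G u v] [set~ u])%N.
Proof.
rewrite ones_rows /degree -sum1_card -big_split /=.
apply: eq_big => [v|v uv]; first by rewrite inE.
rewrite (cardsD1 u) inE adj_sym uv; congr (_ + _)%N.
by apply: eq_card => w; rewrite !inE.
Qed.

(** For B <= d <= m the second estimate of S applies: d + B m / d <= m + B, as
    (m - d)(d - B) is nonnegative. For d <= B the estimate S <= d m suffices. *)
Lemma degree_add_mean_le (R : realFieldType) (d S m ga nu B k : R) :
  0 < d -> d <= m -> 0 <= ga -> 0 <= nu -> 0 <= k ->
  S <= d * m -> S <= d + (ga * d * nu + B * m + k * d) ->
  d + S / d <= m + 1 + ga * nu + B + k.
Proof.
move=> d0 dm ga0 nu0 k0 Sdm SZ.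
have gn : 0 <= ga * nu by exact: mulr_ge0.
have [dB|Bd] := leP d B.
  have : S / d <= m by rewrite ler_pdivrMr // mulrC.
  lra.
rewrite -(ler_pM2r d0) mulrDl divfK ?gt_eqF //.
have : 0 <= (m - d) * (d - B) by rewrite mulr_ge0; lra.
lra.
Qed.

Theorem theorem1p7 (R : realType) (s t n : nat) (V : finType) (G : sgraph V)
  (ht : (3 <= t)%N) (hst : (t <= s)%N)
  (hV : #|V| = n) (hn : (s + t <= n)%N)
  (hconn : connected_graph G) (hfree : Kst_free s t G) :
  qindex R G <=
    n%:R + (s%:R - t%:R + 1) `^ (1 / t%:R) * n%:R `^ (1 - 1 / t%:R)
    + (t%:R - 1) * (n%:R - 1) `^ (1 - 3 / t%:R) + t%:R - 3.
Proof.
(* From here on t = k + 3, so that k is the t - 3 of the statement. *)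
case: t => [|[|[|k]]] // in ht hst hn hfree *; set t : R := k.+3%:R.
have t0 : 0 < t by rewrite ltr0n.
have tE : t = k%:R + 3 by rewrite /t -!natr1; ring.
have tV (a : R) : 0 <= a -> (a `^ (1 / t)) ^+ k.+3 = a.
  by move=> a0; rewrite -powR_mulrn ?powR_ge0 // -powRrM -/t divfK ?gt_eqF // powRr1.
set c : R := s%:R - t + 1; set m : R := n%:R - 1.
have cE : c = (s - k.+2)%N%:R.
  by rewrite /c natrB; [rewrite tE -!natr1; ring | lia].
have mE : m = n.-1%:R by rewrite /m -subn1 natrB //; lia.
have c1 : 1 <= c by rewrite cE ler1n; lia.
have m1 : 1 <= m by rewrite mE ler1n; lia.
have root_ge1 (a : R) : 1 <= a -> 1 <= a `^ (1 / t).
  by move=> a1; rewrite -[leLHS](powRr0 a) ler_powR // divr_ge0 // ltW.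
set ga := c `^ (1 / t); set mu := m `^ (1 / t).
have ga1 : 1 <= ga by exact: root_ge1.
have mu1 : 1 <= mu by exact: root_ge1.
have gaX : ga ^+ k.+3 = c by apply: tV; lra.
have muX : mu ^+ k.+3 = m by apply: tV; lra.
have -> : m `^ (1 - 3 / t) = mu ^+ k.
  rewrite -powR_mulrn ?powR_ge0 // -powRrM; congr (_ `^ _).
  by rewrite tE; field; rewrite -tE gt_eqF.
have nuE : m `^ (1 - 1 / t) = mu ^+ k.+2.
  rewrite -powR_mulrn ?powR_ge0 // -powRrM; congr (_ `^ _).
  by rewrite -!natr1 tE; field; rewrite -tE gt_eqF.
have nu_le : mu ^+ k.+2 <= n%:R `^ (1 - 1 / t).
  rewrite -nuE ge0_ler_powR ?nnegrE //; [|lra|by rewrite /m; lra].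
  by rewrite subr_ge0 ler_pdivrMr // tE; have := ler0n R k; lra.
apply: qindex_le => [||u]; [lia|by move=> u; apply: connected_degree_gt0 hconn _; lia|].
have d0 : (0 < degree G u)%N by apply: connected_degree_gt0 hconn _; lia.
set d : R := (degree G u)%:R; set S : R := (\sum_(v | _) _)%N%:R.
have dm v : (degree G v)%:R <= m by rewrite mE ler_nat -hV degree_le.
have Sdm : S <= d * m.
  rewrite /S natr_sum; apply: (le_trans (ler_sum _ (fun v _ => dm v))).
  rewrite sumr_const -[_ *+ _]mulr_natl ler_wpM2r //; first lra.
  by rewrite ler_nat /degree cardsE.
have SZ : S <= d + (ga * d * mu ^+ k.+2 + k.+2%:R * mu ^+ k * m + k%:R * d).
  rewrite /S sum_degree_neighbours natrD lerD2l.
  have -> : k.+2%:R * mu ^+ k * m = k.+2%:R * mu ^+ (k.+3 + k).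
    by rewrite exprD muX; ring.
  apply: (@ones_le_Zarankiewicz R V V G k.+2 (s - k.+2) k) => //.
  - by rewrite muX mE cardsC1 hV.
  - by rewrite gaX cE.
  (* As u is a common neighbour of X, at most s - 2 others remain. *)
  move=> X XN Xt; have := Kst_free_common _ _ _ _ _ hfree Xt.
  rewrite (cardsD1 u) !inE /=.
  have -> : [forall i in X, G i u].
    by apply/forall_inP => i /(fintype.subsetP XN); rewrite inE adj_sym.
  rewrite add1n => lts; apply: (@leq_trans s.-2); last lia.
  suff -> : common_columns V V G [set~ u] X = common_columns V V G [set: V] X :\ u by lia.
  by apply/setP => w; rewrite !inE.
have nu0 : 0 <= mu ^+ k.+2 by apply: exprn_ge0; lra.
have ga0 : 0 <= ga by lra.
have d_gt0 : 0 < d by rewrite ltr0n.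
apply: (le_trans (degree_add_mean_le _ _ _ _ _ _ _ _ d_gt0 (dm u) ga0 nu0
  (ler0n _ k) Sdm SZ)).
have gn := ler_wpM2l ga0 nu_le.
have -> : t - 1 = k.+2%:R by rewrite tE -!natr1; ring.
rewrite tE in gn *; rewrite /m; lra.
Qed.
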